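(* Let $R$ be a commutative noetherian ring, and let $\mathcal{S}_{1}$ and $\mathcal{S}_{2}$ be Serre subcategories of $R\text{-}\mathrm{mod}$. Then the subcategory $(\mathcal{S}_{1}, \mathcal{S}_{2})$ is a Serre subcategory of $R\text{-}\mathrm{mod}$.
   Context: $R\text{-}\mathrm{mod}$ denotes the category of finitely generated (unitary) $R$-modules. All full subcategories are assumed closed under isomorphisms. A Serre subcategory of an abelian category is a full subcategory closed under subobjects, quotient objects and extensions (in particular it contains the zero object). $(\mathcal{S}_1, \mathcal{S}_2)$ denotes the full subcategory consisting of all $R$-modules $M$ for which there exists a short exact sequence $0 \to S_1 \to M \to S_2 \to 0$ of $R$-modules with $S_1 \in \mathcal{S}_1$ and $S_2 \in \mathcal{S}_2$ (such $M$ are automatically finitely generated when $\mathcal{S}_1,\mathcal{S}_2$ are subcategories of $R\text{-}\mathrm{mod}$). *)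

(* Defs.v *)
From HB Require Import structures.
From mathcomp Require Import all_boot all_algebra.

Set Implicit Arguments.
Unset Strict Implicit.
Unset Printing Implicit Defensive.

Import GRing.Theory.
Local Open Scope ring_scope.

Definition fin_gen (R : comPzRingType) (M : lmodType R) : Prop :=
  exists (n : nat) (e : 'I_n -> M),
    forall x : M, exists c : 'I_n -> R, x = \sum_(i < n) c i *: e i.

(* Ideals are Prop-valued: they need not have decidable membership. *)
Record ideal (R : comPzRingType) (I : R -> Prop) : Prop := Ideal {
  ideal0 : I 0;
  idealD : forall x y, I x -> I y -> I (x + y);
  idealM : forall a x, I x -> I (a * x)
}.

Definition noetherian (R : comPzRingType) : Prop :=
  forall I : R -> Prop, ideal I ->
    exists (n : nat) (e : 'I_n -> R),
      (forall i, I (e i)) /\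
      (forall x, I x -> exists c : 'I_n -> R, x = \sum_(i < n) c i * e i).

Definition surjective (A B : Type) (f : A -> B) : Prop :=
  forall y, exists x, f x = y.

Definition short_exact (R : comPzRingType) (A B C : lmodType R)
    (f : {linear A -> B}) (g : {linear B -> C}) : Prop :=
  [/\ injective f,
      surjective g &
      forall y : B, g y = 0 <-> exists x : A, f x = y].

(* A full subcategory of the category of all R-modules is given by its class
   of objects. Subobjects, quotient objects and extensions are those of the
   category R-mod of finitely generated modules, hence the [fin_gen]
   hypotheses on the modules they produce. *)
Record serre (R : comPzRingType) (S : lmodType R -> Prop) : Prop := Serre {
  serre_fin_gen : forall M : lmodType R, S M -> fin_gen M;
  serre_iso : forall (M N : lmodType R) (f : {linear M -> N}),
    bijective f -> S M -> S N;
  serre_zero : forall Z : lmodType R, (forall z : Z, z = 0) -> S Z;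
  serre_sub : forall (N M : lmodType R) (f : {linear N -> M}),
    fin_gen N -> injective f -> S M -> S N;
  serre_quo : forall (M N : lmodType R) (f : {linear M -> N}),
    fin_gen N -> surjective f -> S M -> S N;
  serre_ext : forall (A B C : lmodType R)
      (f : {linear A -> B}) (g : {linear B -> C}),
    fin_gen B -> short_exact f g -> S A -> S C -> S B
}.

(* Written (S1, S2) in the literature; M ranges over all R-modules, and its finite
   generation is a consequence. *)
Definition ext_subcat (R : comPzRingType) (S1 S2 : lmodType R -> Prop)
    (M : lmodType R) : Prop :=
  exists (A C : lmodType R) (f : {linear A -> M}) (g : {linear M -> C}),
    [/\ short_exact f g, S1 A & S2 C].

(* Main.v *)
Require Import Defs.
From HB Require Import structures.
From mathcomp Require Import all_boot all_algebra.
From mathcomp Require Import boolp.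

Set Implicit Arguments.
Unset Strict Implicit.
Unset Printing Implicit Defensive.

Import GRing.Theory.
Local Open Scope ring_scope.

(** Closure of (S1, S2) under submodules and quotients is a diagram chase: an
    extension of C by A restricts to a submodule, or pushes forward along a
    quotient map, with new end terms that are subobjects or quotients of A and
    C.  The content is closure under extensions, where the filtration of the
    middle module has its factors in S1, S2, S1, S2 in this order, so that an
    S2 factor has to be exchanged with the S1 factor above it.

    The exchange uses the torsion theory of S1.  A finitely generated module M
    has a largest submodule in S1, and the quotient T by it is S1-torsion-free:
    every linear map from a module of S1 to T is zero
    ([torsion_free_quotient]).  So M is in (S1, S2) as soon as T is in S2.

    The key lemma is [torsion_free_swap]: if T is torsion-free and an extension
    of a module Y of S1 by a module X of S2, then T itself is in S2.  Let
    I = (a_1, ..., a_k) be the annihilator of Y.  Since Y is finitely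
    generated, R/I embeds in a finite power of Y, hence lies in S1.  An element
    t of T with I t = 0 is the image of 1 under a map R/I -> T, hence is zero;
    so t |-> (a_1 t, ..., a_k t) is injective on T.  As I kills Y, it takes
    its values in X^k, whence T is in S2.

    For an extension 0 -> L -> M -> N -> 0 of members of (S1, S2), the image X
    of L in T is torsion-free, so it is in S2, while T/X is a quotient of N, so
    it is in (S1, S2).  The preimage P in T of the S1 part of T/X is then in S2
    by the key lemma, and T, an extension of a module of S2 by P, is in S2. *)

(** * Submodules, quotients and factorizations *)

Definition is_submod (R : comPzRingType) (M : lmodType R) (P : M -> Prop) :=
  [/\ P 0, forall x y, P x -> P y -> P (x + y)
    & forall a x, P x -> P (a *: x)].

Definition range_of (A B : Type) (f : A -> B) (y : B) := exists x, f x = y.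

Lemma linear_map_exists (R : comPzRingType) (M N : lmodType R) (h : M -> N) :
  linear h -> exists k : {linear M -> N}, forall x, k x = h x.
Proof.
move=> hl; pose hM := GRing.isLinear.Build R M N *:%R h hl.
by pose k : {linear M -> N} := HB.pack h hM; exists k.
Qed.

Lemma submod_ker (R : comPzRingType) (M N : lmodType R) (f : {linear M -> N}) :
  is_submod (fun x => f x = 0).
Proof.
split=> [|x y fx fy|a x fx]; first exact: linear0.
  by rewrite linearD fx fy addr0.
by rewrite linearZ_LR /= fx scaler0.
Qed.

Lemma submod_range (R : comPzRingType) (M N : lmodType R)
    (f : {linear M -> N}) : is_submod (range_of f).
Proof.
split=> [|_ _ [x <-] [y <-]|a _ [x <-]]; first by exists 0; rewrite linear0.
  by exists (x + y); rewrite linearD.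
by exists (a *: x); rewrite linearZ_LR.
Qed.

Lemma submod_preim (R : comPzRingType) (M N : lmodType R)
    (f : {linear M -> N}) (P : N -> Prop) :
  is_submod P -> is_submod (fun x => P (f x)).
Proof.
case=> P0 PD PZ; split=> [|x y Px Py|a x Px]; first by rewrite linear0.
  by rewrite linearD; apply: PD.
by rewrite linearZ_LR; apply: PZ.
Qed.

Lemma submod_image (R : comPzRingType) (M N : lmodType R)
    (f : {linear M -> N}) (P : M -> Prop) :
  is_submod P -> is_submod (fun y => exists2 x, P x & f x = y).
Proof.
case=> P0 PD PZ.
split=> [|_ _ [x Px <-] [y Py <-]|a _ [x Px <-]].
- by exists 0; rewrite ?linear0.
- by exists (x + y); [apply: PD | rewrite linearD].
- by exists (a *: x); [apply: PZ | rewrite linearZ_LR].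
Qed.

Lemma submod_closed_asbool (R : comPzRingType) (M : lmodType R)
    (P : M -> Prop) : is_submod P ->
  GRing.subsemimod_closed (fun x => `[< P x >]).
Proof.
case=> P0 PD PZ; split; first split.
- by apply/asboolP.
- by move=> x y /asboolP Px /asboolP Py; apply/asboolP/PD.
- by move=> a x /asboolP Px; apply/asboolP/PZ.
Qed.

(** Submodules and quotients occur below only through their embeddings and
    projections; the classical truth value of P provides the decidable predicate
    from which a subtype is formed. *)
Lemma submod_exists (R : comPzRingType) (M : lmodType R) (P : M -> Prop) :
  is_submod P ->
  exists (N : lmodType R) (i : {linear N -> M}),
    injective i /\ forall x, P x <-> range_of i x.
Proof.
move=> /submod_closed_asbool Pc.
pose S : {pred M} := fun x => `[< P x >].
pose T := {x : M | S x}.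
pose Tm := GRing.SubChoice_isSubLmodule.Build R M S T Pc.
pose N : subLmodType S := HB.pack T Tm.
exists N, (\val : {linear N -> M}); split; first exact: val_inj.
move=> x; split=> [Px|[y <-]].
  have Sx : S x by apply/asboolP.
  by exists (exist S x Sx).
by apply/asboolP; apply: (valP y).
Qed.

Lemma quotient_exists (R : comPzRingType) (M : lmodType R) (P : M -> Prop) :
  is_submod P ->
  exists (Q : lmodType R) (p : {linear M -> Q}),
    surjective p /\ forall x, p x = 0 <-> P x.
Proof.
move=> Psub; have [_ _ PZ] := Psub; have Pc := submod_closed_asbool Psub.
pose S : {pred M} := fun x => `[< P x >].
pose Sm := GRing.isSubmodClosed.Build R M S Pc.
pose Sc : zmodClosed M := HB.pack S Sm.
pose Q := Quotient.quot Sc.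
pose pi (x : M) : Q := \pi_Q%qT x.
have piK (q : Q) : pi (repr q) = q by apply: reprK.
have piD : {morph pi : x y / x + y} by move=> x y; apply: raddfD.
have piN : {morph pi : x y / x - y} by move=> x y; apply: raddfB.
have pi_eq x y : pi x = pi y <-> P (x - y).
  rewrite -(asboolE (P (x - y))); have := Quotient.idealrBE Sc x y.
  rewrite unfold_in => -> /=; exact: (rwP eqP).
pose sc (a : R) (q : Q) : Q := pi (a *: repr q).
have scE a x : sc a (pi x) = pi (a *: x).
  by apply/pi_eq; rewrite -scalerBr; apply/PZ/pi_eq; rewrite piK.
have scA a b q : sc a (sc b q) = sc (a * b) q.
  by rewrite -(piK q) !scE scalerA.
have sc1 : left_id 1 sc by move=> q; rewrite -(piK q) scE scale1r.
have scDr : right_distributive sc +%R.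
  by move=> a q r; rewrite -(piK q) -(piK r) -piD !scE -piD scalerDr.
have scDl q : {morph sc^~ q : a b / a + b}.
  by move=> a b /=; rewrite -(piK q) !scE -piD scalerDl.
pose Qm := GRing.Zmodule_isLmodule.Build R Q scA sc1 scDr scDl.
pose QL : lmodType R := HB.pack Q Qm.
have pil : linear (pi : M -> QL).
  by move=> a x y; rewrite piD -scE.
have [p pE] := linear_map_exists pil.
exists QL, p; split=> [q|x]; first by exists (repr q); rewrite pE; apply: piK.
rewrite pE -[in P x](subr0 x) -pi_eq.
by rewrite [pi 0](_ : _ = 0) //; apply: raddf0.
Qed.

Lemma lift_mono (R : comPzRingType) (A B M : lmodType R)
    (i : {linear B -> M}) (f : {linear A -> M}) :
  injective i -> (forall a, range_of i (f a)) ->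
  exists h : {linear A -> B}, forall a, i (h a) = f a.
Proof.
move=> i_inj /choice[h hE].
have hl : linear h.
  by move=> a x y; apply: i_inj; rewrite linearP !hE linearP.
by have [k kE] := linear_map_exists hl; exists k => a; rewrite kE.
Qed.

Lemma factor_epi (R : comPzRingType) (M A B : lmodType R)
    (p : {linear M -> A}) (f : {linear M -> B}) :
  surjective p -> (forall x, p x = 0 -> f x = 0) ->
  exists h : {linear A -> B}, forall x, h (p x) = f x.
Proof.
move=> /choice[s sE] ker_pf.
have fE x y : p x = p y -> f x = f y.
  by move=> /eqP; rewrite -subr_eq0 -linearB => /eqP/ker_pf/eqP;
     rewrite linearB subr_eq0 => /eqP.
have hl : linear (fun a => f (s a)).
  by move=> a x y; rewrite -linearP; apply: fE; rewrite linearP !sE.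
have [k kE] := linear_map_exists hl; exists k => x; rewrite kE.
by apply: fE; rewrite sE.
Qed.

(** * Finite generation over a noetherian ring *)

Definition span (R : comPzRingType) (M : lmodType R) (n : nat) (e : 'I_n -> M)
    (x : M) := exists c : 'I_n -> R, x = \sum_(i < n) c i *: e i.

(** The generators are elements of the ambient module, so finite generation of
    P can be discussed before P is turned into a module. *)
Definition fg_pred (R : comPzRingType) (M : lmodType R) (P : M -> Prop) :=
  exists (n : nat) (e : 'I_n -> M),
    (forall i, P (e i)) /\ forall x, P x -> span e x.

Lemma fin_genE (R : comPzRingType) (M : lmodType R) :
  fin_gen M <-> fg_pred (fun _ : M => True).
Proof.
by split=> [][n [e he]]; exists n, e; [split=> // x _ | move=> x; apply: he.2].
Qed.

Lemma submod_sum (R : comPzRingType) (M : lmodType R) (P : M -> Prop)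
    (n : nat) (c : 'I_n -> R) (e : 'I_n -> M) :
  is_submod P -> (forall i, P (e i)) -> P (\sum_(i < n) c i *: e i).
Proof.
by case=> P0 PD PZ Pe; elim/big_ind: _ => // i _; apply: PZ.
Qed.

Lemma span_cat (R : comPzRingType) (M : lmodType R) (P : M -> Prop)
    (m n : nat) (e : 'I_m -> M) (d : 'I_n -> M) :
  (forall i, P (e i)) -> (forall j, P (d j)) ->
  exists h : 'I_(m + n) -> M, (forall k, P (h k)) /\
    forall x y, span e x -> span d y -> span h (x + y).
Proof.
move=> Pe Pd.
pose glue T (u : 'I_m -> T) (v : 'I_n -> T) (k : 'I_(m + n)) :=
  match split k with inl i => u i | inr j => v j end.
have glueL T u v i : @glue T u v (lshift n i) = u i.
  by rewrite /glue (unsplitK (inl i)).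
have glueR T u v j : @glue T u v (rshift m j) = v j.
  by rewrite /glue (unsplitK (inr j)).
exists (glue _ e d); split=> [k|_ _ [a ->] [b ->]].
  by rewrite /glue; case: split.
exists (glue _ a b); rewrite big_split_ord /=.
by congr (_ + _); apply: eq_bigr => i _; rewrite ?glueL ?glueR.
Qed.

(** Generators of the part of P coming from A, together with lifts to P of
    generators of its image in C, generate P: an element of P minus the
    combination of lifts with the same image in C comes from A. *)
Lemma fg_pred_ext (R : comPzRingType) (A B C : lmodType R)
    (f : {linear A -> B}) (g : {linear B -> C}) (P : B -> Prop) :
  (forall y, g y = 0 -> range_of f y) -> is_submod P ->
  fg_pred (fun a => P (f a)) ->
  fg_pred (fun c => exists2 y, P y & g y = c) -> fg_pred P.
Proof.
move=> ker_g Psub [m [e [Pe spane]]] [n [d [Pd spand]]].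
have [b Pb gb] := fin_all_exists2 Pd.
have [h [Ph spanh]] := @span_cat _ _ P _ _ (f \o e) b Pe Pb.
exists _, h; split=> // x Px.
have [c gx] : span d (g x) by apply: spand; exists x.
pose y := \sum_(j < n) c j *: b j.
have Py : P y by apply: submod_sum.
have [a fa] : range_of f (x - y).
  apply: ker_g; rewrite linearB gx linear_sum.
  apply/eqP; rewrite subr_eq0; apply/eqP/eq_bigr => j _.
  by rewrite linearZ_LR gb.
have [c' a_def] : span e a.
  apply: spane; rewrite fa; case: Psub => _ PD PZ.
  by rewrite -scaleN1r; apply: PD => //; apply: PZ.
rewrite -(subrK y x); apply: spanh; last by exists c.
exists c'; rewrite -fa a_def linear_sum.
by apply: eq_bigr => i _; rewrite linearZ_LR.
Qed.

Lemma fin_gen_ext (R : comPzRingType) (A B C : lmodType R)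
    (f : {linear A -> B}) (g : {linear B -> C}) :
  surjective g -> (forall y, g y = 0 -> range_of f y) ->
  fin_gen A -> fin_gen C -> fin_gen B.
Proof.
move=> g_surj ker_g /fin_genE Afg [n [e spane]].
apply/fin_genE; apply: (fg_pred_ext ker_g) => //.
exists n, e; split=> [i|x _]; last exact: spane.
by have [y <-] := g_surj (e i); exists y.
Qed.

Lemma fin_gen_quo (R : comPzRingType) (A B : lmodType R)
    (f : {linear A -> B}) : surjective f -> fin_gen A -> fin_gen B.
Proof.
move=> f_surj [n [e spane]]; exists n, (f \o e) => y.
have [x <-] := f_surj y; have [c ->] := spane x.
by exists c; rewrite linear_sum; apply: eq_bigr => i _; rewrite linearZ_LR.
Qed.

(** Induction on the number of generators of M: M is an extension of a module
    with one generator fewer by the cyclic module R e_0, and the elements r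
    with r e_0 in P form an ideal. *)
Lemma fg_pred_noetherian (R : comPzRingType) (M : lmodType R)
    (P : M -> Prop) :
  noetherian R -> fin_gen M -> is_submod P -> fg_pred P.
Proof.
move=> hR [n [e spane]]; elim: n => [|n IHn] in M P e spane *.
  move=> _; exists 0%N, e; split=> [[]//|x _]; exact: spane.
move=> Psub.
have fl : linear (fun r : R^o => r *: e ord0).
  by move=> a r s; rewrite scalerDl scalerA.
have [f fE] := linear_map_exists fl.
have [Q [p [p_surj p_ker]]] := quotient_exists (submod_range f).
have ker_p y : p y = 0 -> range_of f y by move/p_ker.
apply: (fg_pred_ext ker_p) => //.
  have [I0 ID IZ] := submod_preim f Psub.
  have idI : ideal (fun r : R => P (f r)) by split=> // a x; apply: IZ.
  have [k [d [Id spand]]] := hR _ idI.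
  by exists k, d; split=> // x Px; apply: spand.
apply: (IHn _ _ (fun i => p (e (lift ord0 i)))); last exact: submod_image.
move=> q; have [x <-] := p_surj q; have [c ->] := spane x.
exists (fun i => c (lift ord0 i)).
rewrite big_ord_recl linearD [p (c ord0 *: _)](_ : _ = 0) ?add0r.
  by rewrite linear_sum; apply: eq_bigr => i _; rewrite linearZ_LR.
by apply/p_ker; exists (c ord0); rewrite fE.
Qed.

Lemma fin_gen_sub (R : comPzRingType) (K M : lmodType R)
    (i : {linear K -> M}) :
  noetherian R -> fin_gen M -> injective i -> fin_gen K.
Proof.
move=> hR Mfg i_inj.
have [n [e [/fin_all_exists[d dE] spane]]] :=
  fg_pred_noetherian hR Mfg (submod_range i).
exists n, d => x; have [c ix] : span e (i x) by apply: spane; exists x.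
exists c; apply: i_inj; rewrite ix linear_sum.
by apply: eq_bigr => j _; rewrite linearZ_LR dE.
Qed.

(** * Closure properties of a Serre subcategory *)

(** A submodule K of the image of f is a subquotient of A, namely the quotient
    of its preimage in A.  This covers both closure properties at once, and K
    gets its finite generation from the noetherian hypothesis. *)
Lemma serre_subquo (R : comPzRingType) (S : lmodType R -> Prop)
    (A B K : lmodType R) (f : {linear A -> B}) (k : {linear K -> B}) :
  noetherian R -> serre S -> injective k ->
  (forall x, range_of f (k x)) -> S A -> S K.
Proof.
move=> hR hS k_inj kf SA.
have [E [i [i_inj Ei]]] := submod_exists (submod_preim f (submod_range k)).
have Efg := fin_gen_sub hR (serre_fin_gen hS SA) i_inj.
have SE := serre_sub hS Efg i_inj SA.
have fik a : range_of k ((f \o i) a) by apply/Ei; exists a.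
have [h hE] := lift_mono k_inj fik.
have h_surj : surjective h.
  move=> x; have [a fa] := kf x.
  have [e ie] : range_of i a by apply/Ei; exists x.
  by exists e; apply: k_inj; rewrite hE /= ie.
exact: serre_quo (fin_gen_quo h_surj Efg) h_surj SE.
Qed.

Lemma serre_range (R : comPzRingType) (S : lmodType R -> Prop)
    (A B : lmodType R) (f : {linear A -> B}) :
  noetherian R -> serre S -> S A ->
  exists (I : lmodType R) (i : {linear I -> B}) (h : {linear A -> I}),
    [/\ S I, injective i, surjective h & forall a, i (h a) = f a].
Proof.
move=> hR hS SA.
have [I [i [i_inj Ii]]] := submod_exists (submod_range f).
have fi a : range_of i (f a) by apply/Ii; exists a.
have [h hE] := lift_mono i_inj fi.
exists I, i, h; split=> // [|x].
  by apply: (serre_subquo hR hS i_inj _ SA) => x; apply/Ii; exists x.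
have [a fa] : range_of f (i x) by apply/Ii; exists x.
by exists a; apply: i_inj; rewrite hE.
Qed.

Lemma serre_quotient (R : comPzRingType) (S : lmodType R -> Prop)
    (A B : lmodType R) (f : {linear A -> B}) :
  serre S -> surjective f -> S A -> S B.
Proof.
move=> hS f_surj SA.
exact: serre_quo (fin_gen_quo f_surj (serre_fin_gen hS SA)) f_surj SA.
Qed.

(** Passing to the kernel and the image of g gives a short exact sequence: the
    kernel is a subquotient of A, and the image is a submodule of C. *)
Lemma ext_subcat_mid (R : comPzRingType) (S1 S2 : lmodType R -> Prop)
    (A M C : lmodType R) (f : {linear A -> M}) (g : {linear M -> C}) :
  noetherian R -> serre S1 -> serre S2 ->
  (forall y, g y = 0 -> range_of f y) -> S1 A -> S2 C ->
  ext_subcat S1 S2 M.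
Proof.
move=> hR hS1 hS2 ker_g SA SC.
have [K [k [k_inj Kk]]] := submod_exists (submod_ker g).
have [I [i [i_inj Ii]]] := submod_exists (submod_range g).
have gi y : range_of i (g y) by apply/Ii; exists y.
have [h hE] := lift_mono i_inj gi.
exists K, I, k, h; split.
- split=> // [x|y].
    have [y gy] : range_of g (i x) by apply/Ii; exists x.
    by exists y; apply: i_inj; rewrite hE.
  split=> [hy|/Kk gy]; first by apply/Kk; rewrite -hE hy linear0.
  by apply: i_inj; rewrite hE gy linear0.
- by apply: (serre_subquo hR hS1 k_inj _ SA) => x; apply/ker_g/Kk; exists x.
- apply: (@serre_subquo _ _ _ _ _ (idfun : {linear C -> C}) i hR hS2) => //.
  by move=> x; exists (i x).
Qed.

Lemma ext_subcat_fin_gen (R : comPzRingType) (S1 S2 : lmodType R -> Prop)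
    (M : lmodType R) :
  serre S1 -> serre S2 -> ext_subcat S1 S2 M -> fin_gen M.
Proof.
move=> hS1 hS2 [A [C [f [g [[_ g_surj ker_g] SA SC]]]]].
have ker_g' y : g y = 0 -> range_of f y by move/ker_g.
exact: fin_gen_ext g_surj ker_g' (serre_fin_gen hS1 SA) (serre_fin_gen hS2 SC).
Qed.

Lemma serre_mid (R : comPzRingType) (S : lmodType R -> Prop)
    (A M C : lmodType R) (f : {linear A -> M}) (g : {linear M -> C}) :
  noetherian R -> serre S ->
  (forall y, g y = 0 -> range_of f y) -> S A -> S C -> S M.
Proof.
move=> hR hS ker_g SA SC.
have SM : ext_subcat S S M by apply: ext_subcat_mid ker_g SA SC.
have Mfg := ext_subcat_fin_gen hS hS SM.
have [A' [C' [f' [g' [ex' SA' SC']]]]] := SM.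
exact: serre_ext Mfg ex' SA' SC'.
Qed.

Lemma serre_prod (R : comPzRingType) (S : lmodType R -> Prop)
    (A B : lmodType R) :
  noetherian R -> serre S -> S A -> S B -> S (A * B)%type.
Proof.
move=> hR hS SA SB.
have fl : linear (fun a : A => (a, 0) : (A * B)%type).
  by move=> a x y; congr (_, _); rewrite /= scaler0 addr0.
have [f fE] := linear_map_exists fl.
pose g : {linear (A * B)%type -> B} := snd.
apply: (@serre_mid _ _ _ _ _ f g hR hS) => // -[a b] /= b0.
by exists a; rewrite fE -b0.
Qed.

(** The map v is (u_0, ..., u_{n-1}), with values in a power of X.  Only its
    kernel is recorded, so that its target can grow along the induction. *)
Lemma serre_joint_kernel (R : comPzRingType) (S : lmodType R -> Prop)
    (T X : lmodType R) (n : nat) (u : 'I_n -> {linear T -> X}) :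
  noetherian R -> serre S -> S X ->
  exists (B : lmodType R) (v : {linear T -> B}),
    S B /\ forall x, v x = 0 -> forall i, u i x = 0.
Proof.
move=> hR hS SX; elim: n => [|n IHn] in u *.
  exists X, (GRing.null_fun X : {linear T -> X}).
  by split=> // x _ [].
have [B [v [SB v0]]] := IHn (fun i => u (lift ord0 i)).
have wl : linear (fun x => (u ord0 x, v x) : (X * B)%type).
  by move=> a x y; rewrite !linearP.
have [w wE] := linear_map_exists wl.
exists (X * B)%type, w; split=> [|x]; first exact: serre_prod.
rewrite wE => -[ux vx] i.
by case: (unliftP ord0 i) => [j|] ->; [apply: v0 | ].
Qed.

(** * Torsion with respect to a Serre subcategory *)

(** The classical condition that the zero submodule is the only one in S; it
    is phrased with maps because images of members of S are in S. *)
Definition torsion_free (R : comPzRingType) (S : lmodType R -> Prop)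
    (T : lmodType R) :=
  forall (A : lmodType R) (f : {linear A -> T}), S A -> forall a, f a = 0.

Definition torsion (R : comPzRingType) (S : lmodType R -> Prop)
    (M : lmodType R) (x : M) :=
  exists (A : lmodType R) (f : {linear A -> M}), S A /\ range_of f x.

Lemma torsion_free_sub (R : comPzRingType) (S : lmodType R -> Prop)
    (K T : lmodType R) (k : {linear K -> T}) :
  injective k -> torsion_free S T -> torsion_free S K.
Proof.
move=> k_inj T_tf A f SA a; apply: k_inj.
by rewrite linear0; apply: (T_tf A (k \o f)).
Qed.

Lemma torsion_add (R : comPzRingType) (S : lmodType R -> Prop)
    (M A B : lmodType R) (f : {linear A -> M}) (g : {linear B -> M}) :
  noetherian R -> serre S -> S A -> S B ->
  exists (D : lmodType R) (h : {linear D -> M}),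
    S D /\ forall a b, range_of h (f a + g b).
Proof.
move=> hR hS SA SB.
have hl : linear (fun d : A * B => f d.1 + g d.2).
  by move=> a x y /=; rewrite !linearP scalerDr addrACA.
have [h hE] := linear_map_exists hl.
exists (A * B)%type, h; split; first exact: serre_prod.
by move=> a b; exists (a, b); rewrite hE.
Qed.

Lemma submod_torsion (R : comPzRingType) (S : lmodType R -> Prop)
    (M : lmodType R) :
  noetherian R -> serre S -> is_submod (@torsion R S M).
Proof.
move=> hR hS; split=> [|x y|r x].
- pose Z : lmodType R := 'rV[R]_0.
  exists Z, (GRing.null_fun M : {linear Z -> M}).
  by split; [apply: (serre_zero hS) => z; apply: thinmx0 | exists 0].
- move=> [A [f [SA [a <-]]]] [B [g [SB [b <-]]]].
  by have [D [h [SD hE]]] := torsion_add f g hR hS SA SB; exists D, h.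
- move=> [A [f [SA [a <-]]]]; exists A, f; split=> //.
  by exists (r *: a); rewrite linearZ_LR.
Qed.

Lemma torsion_family (R : comPzRingType) (S : lmodType R -> Prop)
    (M : lmodType R) (n : nat) (e : 'I_n -> M) :
  noetherian R -> serre S -> (forall i, torsion S (e i)) ->
  exists (A : lmodType R) (f : {linear A -> M}),
    S A /\ forall i, range_of f (e i).
Proof.
move=> hR hS; elim: n => [|n IHn] in e * => e_tor.
  have [[A [f [SA _]]] _ _] := submod_torsion M hR hS.
  by exists A, f; split=> // -[].
have [A [f [SA [a fa]]]] := e_tor ord0.
have [B [g [SB gE]]] := IHn _ (fun i => e_tor (lift ord0 i)).
have [D [h [SD hE]]] := torsion_add f g hR hS SA SB.
exists D, h; split=> // i; case: (unliftP ord0 i) => [j|] ->.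
  by have [b <-] := gE j; rewrite -[g b]add0r -(linear0 f).
by rewrite -fa -[f a]addr0 -(linear0 g).
Qed.

(** The torsion elements form a submodule, generated by finitely many elements
    because M is noetherian, hence covered by a single module of S.  If B in S
    maps to M modulo torsion, the preimage K in M of its image is an extension
    of a quotient of B by the torsion submodule, so K is in S and consists of
    torsion elements: the map from B is zero. *)
Lemma torsion_free_quotient (R : comPzRingType) (S : lmodType R -> Prop)
    (M : lmodType R) :
  noetherian R -> serre S -> fin_gen M ->
  exists (A T : lmodType R) (f : {linear A -> M}) (p : {linear M -> T}),
    [/\ S A, surjective p, forall x, p x = 0 -> range_of f x
      & torsion_free S T].
Proof.
move=> hR hS Mfg; have tor_sub := submod_torsion M hR hS.
have [n [e [e_tor spane]]] := fg_pred_noetherian hR Mfg tor_sub.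
have [A [f [SA fe]]] := torsion_family hR hS e_tor.
have [T [p [p_surj p_ker]]] := quotient_exists tor_sub.
have ker_p x : p x = 0 -> range_of f x.
  by move=> /p_ker/spane[c ->]; apply: submod_sum fe; apply: submod_range.
exists A, T, f, p; split=> // B g SB b.
have [K [k [k_inj Kk]]] := submod_exists (submod_preim p (submod_range g)).
have pkg x : range_of g (p (k x)) by apply/Kk; exists x.
have [J [j [g' [SJ j_inj _ g'E]]]] := serre_range g hR hS SB.
have pkj x : range_of j ((p \o k) x).
  by have [y gy] := pkg x; exists (g' y); rewrite g'E.
have [q qE] := lift_mono j_inj pkj.
have [L [l [l_inj Ll]]] := submod_exists (submod_ker q).
have SL : S L.
  apply: (@serre_subquo _ _ _ _ _ f (k \o l) hR hS) => //.
    exact: inj_comp.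
  move=> x /=; apply: ker_p; have /= <- := qE (l x).
  have /Ll -> : range_of l (l x) by exists x.
  exact: linear0.
have ker_q x : q x = 0 -> range_of l x by move/Ll.
have SK : S K by apply: serre_mid ker_q SL SJ.
have [x px] := p_surj (g b); rewrite -px; apply/p_ker.
by exists K, k; split=> //; apply/Kk; exists b.
Qed.

(** F / ker u embeds in B, hence lies in S, and w factors through it. *)
Lemma torsion_free_kernel (R : comPzRingType) (S : lmodType R -> Prop)
    (F B T : lmodType R) (u : {linear F -> B}) (w : {linear F -> T}) :
  noetherian R -> serre S -> S B -> torsion_free S T ->
  (forall x, u x = 0 -> w x = 0) -> forall x, w x = 0.
Proof.
move=> hR hS SB T_tf uw x.
have [I [i [i_inj Ii]]] := submod_exists (submod_range u).
have ui a : range_of i (u a) by apply/Ii; exists a.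
have [h hE] := lift_mono i_inj ui.
have SI : S I.
  by apply: (@serre_subquo _ _ _ _ _ (idfun : {linear B -> B}) i hR hS) => // y;
     exists (i y).
have h_surj : surjective h.
  move=> y; have [a ua] : range_of u (i y) by apply/Ii; exists y.
  by exists a; apply: i_inj; rewrite hE.
have hw y : h y = 0 -> w y = 0 by move=> hy; apply: uw; rewrite -hE hy linear0.
have [v vE] := factor_epi h_surj hw.
by rewrite -vE; apply: T_tf.
Qed.

(** * Interchanging the two factors *)

(** Multiplication by generators a_j of the annihilator of the image of g embeds
    T into a finite power of the image of f: an element killed by all a_j is
    the image of 1 under a map to T from R modulo the annihilator, a module of
    S1. *)
Lemma torsion_free_swap (R : comPzRingType) (S1 S2 : lmodType R -> Prop)
    (X T Y : lmodType R) (f : {linear X -> T}) (g : {linear T -> Y}) :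
  noetherian R -> serre S1 -> serre S2 -> fin_gen T -> torsion_free S1 T ->
  (forall t, g t = 0 -> range_of f t) -> S2 X -> S1 Y -> S2 T.
Proof.
move=> hR hS1 hS2 [n [e spane]] T_tf ker_g SX SY.
have mul_elt (M : lmodType R) (m : M) :
    exists h : {linear R^o -> M}, forall r : R, h r = r *: m.
  apply: linear_map_exists => a r s.
  by rewrite scalerDl scalerA.
have [u uE] := fin_all_exists (fun i => mul_elt Y (g (e i))).
(* The map v is r |-> (r g(e_i))_i: its kernel annihilates the image of g, and
   R modulo its kernel embeds in B. *)
have [B [v [SB v0]]] := serre_joint_kernel u hR hS1 SY.
have kill r t : v r = 0 -> r *: g t = 0.
  move=> vr; have [c ->] := spane t; rewrite linear_sum scaler_sumr.
  apply: big1 => i _; rewrite linearZ_LR scalerA mulrC -scalerA.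
  by rewrite -uE (v0 r vr) scaler0.
have [I0 ID IM] := submod_ker v.
have idI : ideal (fun r : R => v r = 0) by split=> // a x; apply: IM.
have [k [a [Ia spana]]] := hR _ idI.
have [Z [z [f' [SZ z_inj _ f'E]]]] := serre_range f hR hS2 SX.
have mul_lift j : exists h : {linear T -> Z}, forall t, z (h t) = a j *: t.
  have [m mE] : exists m : {linear T -> T}, forall t, m t = a j *: t.
    apply: linear_map_exists => b x y.
    by rewrite scalerDr !scalerA mulrC.
  have mz t : range_of z (m t).
    have [x fx] : range_of f (m t) by apply: ker_g; rewrite mE linearZ_LR kill.
    by exists (f' x); rewrite f'E.
  by have [h hE] := lift_mono z_inj mz; exists h => t; rewrite hE mE.
have [w wE] := fin_all_exists mul_lift.
(* The map d is t |-> (a_1 t, ..., a_k t). *)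
have [D [d [SD d0]]] := serre_joint_kernel w hR hS2 SZ.
have d_inj t : d t = 0 -> t = 0.
  move=> dt; have [m mE] := mul_elt T t.
  rewrite -[t]scale1r -mE; apply: (torsion_free_kernel hR hS1 SB T_tf) => r vr.
  have [c ->] := spana r vr; rewrite mE scaler_suml; apply: big1 => j _.
  by rewrite -scalerA -wE (d0 t dt) linear0 scaler0.
pose z0 : {linear D -> T} := GRing.null_fun T.
apply: (@serre_mid _ _ _ _ _ z0 d hR hS2) => //.
by move=> t /d_inj ->; exists 0.
Qed.

(** The S1 part of M dies in T, so T is a quotient of the S2 part. *)
Lemma ext_subcat_torsion_free (R : comPzRingType) (S1 S2 : lmodType R -> Prop)
    (M T : lmodType R) (p : {linear M -> T}) :
  serre S2 -> surjective p -> torsion_free S1 T -> ext_subcat S1 S2 M -> S2 T.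
Proof.
move=> hS2 p_surj T_tf [A [C [f [g [[_ g_surj ker_g] SA SC]]]]].
have gp x : g x = 0 -> p x = 0.
  by move=> /ker_g[a <-]; apply: (T_tf A (p \o f)).
have [h hE] := factor_epi g_surj gp.
apply: (serre_quotient (f := h) hS2) SC => t.
by have [x <-] := p_surj t; exists (g x).
Qed.

(** The S1 part of N is the image of A; what remains of N is a quotient of C. *)
Lemma ext_subcat_quo (R : comPzRingType) (S1 S2 : lmodType R -> Prop)
    (M N : lmodType R) (h : {linear M -> N}) :
  noetherian R -> serre S1 -> serre S2 -> surjective h ->
  ext_subcat S1 S2 M -> ext_subcat S1 S2 N.
Proof.
move=> hR hS1 hS2 h_surj [A [C [f [g [[_ g_surj ker_g] SA SC]]]]].
have [Q [q [q_surj q_ker]]] := quotient_exists (submod_range (h \o f)).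
have gqh x : g x = 0 -> (q \o h) x = 0.
  by move=> /ker_g[a <-]; apply/q_ker; exists a.
have [c cE] := factor_epi g_surj gqh.
apply: (@ext_subcat_mid _ _ _ _ _ _ (h \o f) q) => // [y /q_ker//|].
apply: (serre_quotient (f := c) hS2) SC => y.
have [y' <-] := q_surj y; have [x <-] := h_surj y'.
by exists (g x); rewrite cE.
Qed.

Lemma ext_subcat_sub (R : comPzRingType) (S1 S2 : lmodType R -> Prop)
    (N M : lmodType R) (h : {linear N -> M}) :
  noetherian R -> serre S1 -> serre S2 -> injective h ->
  ext_subcat S1 S2 M -> ext_subcat S1 S2 N.
Proof.
move=> hR hS1 hS2 h_inj [A [C [f [g [[_ _ ker_g] SA SC]]]]].
have [K [k [k_inj Kk]]] := submod_exists (submod_ker (g \o h)).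
apply: (@ext_subcat_mid _ _ _ _ _ _ k (g \o h)) => // [y /Kk//|].
apply: (@serre_subquo _ _ _ _ _ f (h \o k) hR hS1) => //; first exact: inj_comp.
by move=> x; apply/ker_g/Kk; exists x.
Qed.

(** Modulo its torsion, M becomes a module T filtered with factors in S2, S1,
    S2; the swap merges the first two. *)
Lemma ext_subcat_ext (R : comPzRingType) (S1 S2 : lmodType R -> Prop)
    (L M N : lmodType R) (i : {linear L -> M}) (q : {linear M -> N}) :
  noetherian R -> serre S1 -> serre S2 -> fin_gen M -> short_exact i q ->
  ext_subcat S1 S2 L -> ext_subcat S1 S2 N -> ext_subcat S1 S2 M.
Proof.
move=> hR hS1 hS2 Mfg [_ q_surj ker_q] EL EN.
have [A [T [f [p [SA p_surj ker_p T_tf]]]]] := torsion_free_quotient hR hS1 Mfg.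
suff ST : S2 T by apply: ext_subcat_mid ker_p SA ST.
have Tfg := fin_gen_quo p_surj Mfg.
(* X is the image of L in T; it is torsion-free, as a submodule of T. *)
have [X [x [x_inj Xx]]] := submod_exists (submod_range (p \o i)).
have pix l : range_of x ((p \o i) l) by apply/Xx; exists l.
have [i' i'E] := lift_mono x_inj pix.
have SX : S2 X.
  apply: (ext_subcat_torsion_free (p := i') hS2) EL.
    move=> y; have [l il] : range_of (p \o i) (x y) by apply/Xx; exists y.
    by exists l; apply: x_inj; rewrite i'E.
  exact: torsion_free_sub x_inj T_tf.
(* U = T/X is also a quotient of N. *)
have [U [u [u_surj u_ker]]] := quotient_exists (submod_range x).
have qup m : q m = 0 -> (u \o p) m = 0.
  by move=> /ker_q[l <-]; apply/u_ker; rewrite -[p (i l)]i'E; exists (i' l).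
have [n nE] := factor_epi q_surj qup.
have [B [C [b [c [[b_inj c_surj ker_c] SB SC]]]]] : ext_subcat S1 S2 U.
  apply: (ext_subcat_quo (h := n) hR hS1 hS2) EN => y.
  have [t <-] := u_surj y; have [m <-] := p_surj t.
  by exists (q m); rewrite nE.
(* P is the preimage in T of the S1 part B of U, an extension of B by X. *)
have [P [k [k_inj Pk]]] := submod_exists (submod_ker (c \o u)).
suff SP : S2 P.
  by apply: (@serre_mid _ _ _ _ _ k (c \o u) hR hS2) => // t /Pk.
have ukb t : range_of b ((u \o k) t) by apply/ker_c/Pk; exists t.
have [g gE] := lift_mono b_inj ukb.
have xk y : range_of k (x y).
  apply/Pk => /=; suff -> : u (x y) = 0 by rewrite linear0.
  by apply/u_ker; exists y.
have [xP xPE] := lift_mono k_inj xk.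
apply: (@torsion_free_swap _ _ _ _ _ _ xP g hR hS1 hS2) => //.
- exact: fin_gen_sub k_inj.
- exact: torsion_free_sub k_inj T_tf.
move=> t gt; have [y xy] : range_of x (k t).
  by apply/u_ker; have /= <- := gE t; rewrite gt linear0.
by exists y; apply: k_inj; rewrite xPE.
Qed.

Theorem theorem2p3 (R : comPzRingType) (S1 S2 : lmodType R -> Prop)
    (hR : noetherian R) (hS1 : serre S1) (hS2 : serre S2) :
  serre (ext_subcat S1 S2).
Proof.
split.
- by move=> M; apply: ext_subcat_fin_gen.
- move=> M N f [f' _ fK]; apply: ext_subcat_quo => // y.
  by exists (f' y); apply: fK.
- move=> Z Z0; apply: (@ext_subcat_mid _ _ _ _ _ _
    (idfun : {linear Z -> Z}) (idfun : {linear Z -> Z})) => //.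
  + by move=> y _; exists y.
  + exact: serre_zero.
  + exact: serre_zero.
- by move=> N M h _; apply: ext_subcat_sub.
- by move=> M N h _; apply: ext_subcat_quo.
- by move=> A B C f g; apply: ext_subcat_ext.
Qed.
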